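(* Let $L>0$ and $m,r$ be integers with $1<r<m-1$. Then all coefficients in the $q$-expansion of \[ \frac{1}{(q;q^m)_L\,(q^{m-1};q^m)_L} - \frac{1}{(q^r;q^m)_L\,(q^{m-r};q^m)_L} \] are nonnegative if and only if $r\nmid(m-r)$ and $(m-r)\nmid r$.
   Context: $(a;q)_L=\prod_{j=0}^{L-1}(1-aq^j)$. *)

(* Defs.v *)
From mathcomp Require Import all_boot all_order all_algebra.
Set Implicit Arguments. Unset Strict Implicit. Unset Printing Implicit Defensive.
Import Order.TTheory GRing.Theory Num.Theory.
Local Open Scope ring_scope.

Definition qpoch (a m L : nat) : {poly int} :=
  \prod_(j < L) (1 - 'X^(a + m * j)).

(* f : nat -> int is the q-expansion (formal power series coefficients) of 1/P,
   i.e. f * P = 1 as formal power series in q. *)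
Definition is_qexp_inv (P : {poly int}) (f : nat -> int) : Prop :=
  forall n : nat, \sum_(k < n.+1) f k * P`_(n - k) = (n == 0%N)%:R.

(* Main.v *)
Require Import Defs.
From mathcomp Require Import all_boot all_order all_algebra.
From mathcomp Require Import ring zify.
Import Order.TTheory GRing.Theory Num.Theory.

(** Both coefficients count multiplicity vectors [x] indexed by the [2 L]
    parts. Put [s = m - r], assume [r < s], and let [D] be the number of parts
    congruent to [r] minus the number of parts congruent to [s] mod [m].
    If [D >= 0], read [r + j m] and [s + j m] as [1 + j m] and [m - 1 + j m] and
    add [(r - 1) D] ones; the new difference is [r D].
    If [D = - E < 0], exchange the two classes first and add [(s - 1) E] ones;
    the new difference is [s E]. The two recipes collide only when [r] divides
    [s E]; then one adds a part [m - 1] and correspondingly fewer ones, which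
    gives the difference [s E - m]. As neither of [r], [s] divides the other,
    this is a multiple of neither, so the new difference determines the recipe
    and [D], and the map is injective.
    If [r] divides [s], then [s] has two partitions into parts [r] and [s], but
    only one into parts [1] and [m - 1]. *)

(** * Coefficients of the reciprocal product as counts of multiplicity vectors *)

Section Counting.
Local Open Scope ring_scope.

Lemma coef_prod_geometric (I : finType) (a : I -> nat) (N n : nat) :
  (\prod_i \sum_(k < N) 'X^(k * a i) : {poly int})`_n =
  (#|[set x : {ffun I -> 'I_N} | (\sum_i x i * a i == n)%N]|)%:R.
Proof.
rewrite bigA_distr_bigA /= coef_sum -sum1_card natr_sum [RHS]big_mkcond /=.
apply: eq_bigr => x _; rewrite inE -(big_morph _ (exprD _) (expr0 _)) coefXn.
by rewrite eq_sym; case: eqP.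
Qed.

Lemma prod_eq1_modXn (I : finType) (N : nat) (F : I -> {poly int}) :
  (forall i, exists q, F i = 1 + q * 'X^N) ->
  exists q, \prod_i F i = 1 + q * 'X^N.
Proof.
move=> HF; apply: (big_ind (fun p => exists q, p = 1 + q * 'X^N)) => //.
  by exists 0; rewrite mul0r addr0.
move=> _ _ [p ->] [q ->]; exists (p + q + p * q * 'X^N); ring.
Qed.

(** Modulo ['X^(n.+1)] both the truncation of [f] and the product of truncated geometric sums invert
    the same product, so they agree there. *)
Lemma qexp_inv_count (I : finType) (a : I -> nat) (f : nat -> int) (n : nat) :
  (forall i, (0 < a i)%N) -> is_qexp_inv (\prod_i (1 - 'X^(a i))) f ->
  f n = (#|[set x : {ffun I -> 'I_n.+1} | (\sum_i x i * a i == n)%N]|)%:R.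
Proof.
move=> a_gt0 Hf; set P := \prod_i _ in Hf.
rewrite -coef_prod_geometric; set G := \prod_i _.
have [u PG] : exists u : {poly int}, P * G = 1 + u * 'X^(n.+1).
  rewrite /P /G -big_split /=; apply: prod_eq1_modXn => i.
  (* The geometric sum telescopes to [1 - 'X^(a i * n.+1)]; as [a i] is positive, ['X^(n.+1)] splits
     off. *)
  exists (- 'X^((a i).-1 * n.+1)).
  under eq_bigr do rewrite mulnC exprM.
  rewrite -[1 - _]opprB mulNr -subrX1 opprB -exprM mulNr -exprD.
  by rewrite -mulSnr prednK.
pose F : {poly int} := \poly_(k < n.+1) f k.
have [v FP] : exists v : {poly int}, F * P = 1 + v * 'X^(n.+1).
  exists (drop_poly n.+1 (F * P)).
  rewrite -{1}(poly_take_drop n.+1 (F * P)); congr (_ + _).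
  apply/polyP => i; rewrite coef_take_poly coef1.
  case: ltnP => [lt_in|]; last by case: i.
  rewrite -Hf coefM; apply: eq_bigr => k _.
  by rewrite coef_poly (leq_trans (ltn_ord k)).
have -> : f n = F`_n by rewrite coef_poly ltnSn.
have : F + F * u * 'X^(n.+1) = G + G * v * 'X^(n.+1).
  by rewrite -mulrA -[X in X + _]mulr1 -mulrDr -PG mulrA FP; ring.
by move/(congr1 (fun p : {poly int} => p`_n)); rewrite !coefD !coefMXn ltnSn !addr0.
Qed.

End Counting.

(** As [b] is positive, every multiplicity in a vector of weight [n] is at most [n], so [inord]
    loses nothing on the images under [phi]. *)
Lemma leq_card_weighted (I : finType) (a b : I -> nat) (n : nat)
    (phi : (I -> nat) -> I -> nat) :
  (forall i, 0 < b i) ->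
  (forall x, \sum_i phi x i * b i = \sum_i x i * a i) ->
  (forall x y, phi x =1 phi y -> x =1 y) ->
  #|[set x : {ffun I -> 'I_n.+1} | \sum_i x i * a i == n]| <=
  #|[set x : {ffun I -> 'I_n.+1} | \sum_i x i * b i == n]|.
Proof.
move=> b_gt0 phi_sum phi_inj.
pose psi (x : {ffun I -> 'I_n.+1}) : {ffun I -> 'I_n.+1} :=
  [ffun i => inord (phi (fun i => val (x i)) i)].
have psiE (x : {ffun I -> 'I_n.+1}) i : \sum_i x i * a i == n -> psi x i = phi (fun i => val (x i)) i :> nat.
  move=> /eqP Hx; rewrite ffunE inordK // ltnS -[leqRHS]Hx -phi_sum (bigD1 i) //=.
  by apply: leq_trans (leq_addr _ _); rewrite leq_pmulr.
rewrite -(@card_in_imset _ _ psi).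
  apply/subset_leq_card/subsetP => _ /imsetP[x xP ->]; rewrite !inE in xP *.
  rewrite -[eqbRHS](eqP xP) -phi_sum; apply/eqP; apply: eq_bigr => i _.
  by rewrite psiE.
move=> x y; rewrite !inE => xP yP eq_psi; apply/ffunP => i; apply/val_inj.
apply: (phi_inj (fun i => val (x i)) (fun i => val (y i))) => j.
by rewrite -!psiE // eq_psi.
Qed.

(** The Boolean keeps the two classes apart even when [a = b], as happens for [r = m - r]. *)
Definition part (a b m : nat) {L : nat} (i : bool * 'I_L) : nat :=
  (if i.1 then a else b) + m * i.2.

Lemma qpoch_mul_part (a b m L : nat) :
  (qpoch a m L * qpoch b m L)%R =
  (\prod_(i : bool * 'I_L) (1 - 'X^(part a b m i)))%R.
Proof.
pose F c (j : 'I_L) : {poly int} := (1 - 'X^(part a b m (c, j)))%R.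
rewrite (eq_bigr (fun i => F i.1 i.2)) => [|[] //].
by rewrite -(pair_bigA _ F) big_bool.
Qed.

Lemma qexp_inv_part_count (a b m L : nat) (f : nat -> int) (n : nat) :
  0 < a -> 0 < b -> is_qexp_inv (qpoch a m L * qpoch b m L)%R f ->
  f n = (#|[set x : {ffun bool * 'I_L -> 'I_n.+1} |
            (\sum_i x i * part a b m i == n)%N]|)%:R%R.
Proof.
move=> a_gt0 b_gt0; rewrite qpoch_mul_part; apply: qexp_inv_count => -[c j].
by rewrite /part addn_gt0 /=; case: c; rewrite ?a_gt0 ?b_gt0.
Qed.

Definition colour {L : nat} (x : bool * 'I_L -> nat) (c : bool) : nat :=
  \sum_j x (c, j).

Definition level {L : nat} (x : bool * 'I_L -> nat) : nat :=
  \sum_(j < L) j * (x (true, j) + x (false, j)).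

(** The weight sees a vector only through its class totals and its level; a map that keeps the level
    need only balance the totals. *)
Lemma sum_part (a b m L : nat) (x : bool * 'I_L -> nat) :
  \sum_i x i * part a b m i =
  a * colour x true + b * colour x false + m * level x.
Proof.
pose F c (j : 'I_L) := x (c, j) * part a b m (c, j).
rewrite (eq_bigr (fun i => F i.1 i.2)) => [|[] //].
rewrite -(pair_bigA _ F) big_bool /= /F /colour /level !big_distrr -!big_split /=.
by apply: eq_bigr => j _; rewrite /part /=; lia.
Qed.

(* [sw] exchanges the two classes; [c] parts [(true, 0)] and [e] parts
   [(false, 0)] are then added. *)
Definition shift {L : nat} (p : bool * nat * nat) (x : bool * 'I_L.+1 -> nat)
    (i : bool * 'I_L.+1) : nat :=
  let: (sw, c, e) := p in
  x (i.1 (+) sw, i.2) + (if i.2 == ord0 then if i.1 then c else e else 0).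

Lemma shift_inj (L : nat) (p : bool * nat * nat) (x y : bool * 'I_L.+1 -> nat) :
  shift p x =1 shift p y -> x =1 y.
Proof.
case: p => -[sw c] e Hxy [b j]; have := Hxy (b (+) sw, j).
by rewrite /shift /= -addbA addbb addbF => /addIn.
Qed.

Lemma colour_shift (L : nat) sw c e (x : bool * 'I_L.+1 -> nat) (b : bool) :
  colour (shift (sw, c, e) x) b = colour x (b (+) sw) + (if b then c else e).
Proof.
rewrite /colour /shift /= big_split /=; congr addn.
by rewrite -big_mkcond /= big_pred1_eq.
Qed.

Lemma level_shift (L : nat) p (x : bool * 'I_L.+1 -> nat) :
  level (shift p x) = level x.
Proof.
case: p => -[sw c] e; apply: eq_bigr => j _; rewrite /shift /=.
by case: eqP => [->|_] //; case: sw => /=; lia.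
Qed.

(** [S] and [T] are the totals of the classes of [r] and [s]. In the last branch one part
    [r + s - 1] replaces that many of the [(s - 1) * (T - S)] ones. *)
Definition shift_data (r s S T : nat) : bool * nat * nat :=
  if T <= S then (false, (r - 1) * (S - T), 0)
  else if ~~ (r %| s * (T - S)) then (true, (s - 1) * (T - S), 0)
  else (true, s * (T - S) - (r + s) - (T - S - 1), 1).

(** * The weight-preserving injection *)

Section Transfer.
Variables r s : nat.
Hypotheses (r_gt1 : 1 < r) (lt_rs : r < s) (ndvd : ~~ (r %| s)).

(** [E = 1] would make [r] divide [s], and [r < s] settles [E >= 2]. Hence the subtractions in the
    last branch of [shift_data] never truncate. *)
Lemma shift_data_bound (E : nat) :
  0 < E -> r %| s * E -> r + s + (E - 1) <= s * E.
Proof.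
move=> E_gt0 dvdE.
have : E != 1 by apply: contraNneq ndvd => E1; rewrite E1 muln1 in dvdE.
by nia.
Qed.

Lemma shift_dataP (S T : nat) (sw : bool) (c e : nat) :
  shift_data r s S T = (sw, c, e) ->
  exists D D' : nat,
  [/\ (if sw then T else S) = (if sw then S else T) + D, D + c = e + D' &
  [\/ [/\ sw = false, c = (r - 1) * D, e = 0 & D' = r * D],
      [/\ sw = true, c = (s - 1) * D, e = 0, D' = s * D & ~~ (r %| s * D)] |
      [/\ sw = true, c = s * D - (r + s) - (D - 1), e = 1,
         D' + (r + s) = s * D & r %| s * D]]].
Proof.
rewrite /shift_data; case: leqP => [le_TS|lt_ST].
  case=> <- <- <-; exists (S - T), (r * (S - T)).
  by split; [lia | nia | constructor 1].
case: ifP => [ndvdE|/negbFE dvdE] [<- <- <-].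
  exists (T - S), (s * (T - S)); by split; [lia | nia | constructor 2].
have := shift_data_bound (T - S); rewrite subn_gt0 => /(_ lt_ST dvdE) bnd.
exists (T - S), (s * (T - S) - (r + s)); split; [lia | nia |].
by constructor 3; split=> //; lia.
Qed.

(** The first recipe yields a multiple of [r], the second a multiple of [s] but not of [r], the
    third a multiple of neither; within a recipe the new difference fixes [D]. *)
Lemma shift_data_inj (S T S' T' : nat) (sw sw' : bool) (c e c' e' : nat) :
  shift_data r s S T = (sw, c, e) -> shift_data r s S' T' = (sw', c', e') ->
  (if sw then T else S) + c = (if sw' then T' else S') + c' ->
  (if sw then S else T) + e = (if sw' then S' else T') + e' ->
  (sw, c, e) = (sw', c', e').
Proof.
have s_gt0 : 0 < s by lia.
have r_gt0 : 0 < r by lia.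
have ndvd_sr : ~~ (s %| r) by apply/negP => /dvdn_leq; lia.
move=> /shift_dataP[D [F [ED EF CF]]] /shift_dataP[D' [F' [ED' EF' CF']]] Et Ef.
(* Both are the difference of the same final class totals. *)
have eqF : F = F' by lia.
rewrite -{}eqF {ED ED' EF EF' Et Ef F'} in CF'.
case: CF CF' => [[-> -> -> HF]|[-> -> -> HF ND]|[-> -> -> HF ND]]
  [[-> -> -> HF']|[-> -> -> HF' ND']|[-> -> -> HF' ND']].
- by have -> : D = D' by apply/eqP; rewrite -(eqn_pmul2l r_gt0) -HF HF'.
- by rewrite -HF' HF dvdn_mulr in ND'.
- move: ND'; rewrite -HF' HF dvdn_addr ?dvdn_mulr // dvdn_addr //.
  by rewrite (negbTE ndvd).
- by rewrite -HF HF' dvdn_mulr in ND.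
- by have -> : D = D' by apply/eqP; rewrite -(eqn_pmul2l s_gt0) -HF HF'.
- have := dvdn_mulr D' (dvdnn s); rewrite -HF' HF dvdn_addr ?dvdn_mulr //.
  by rewrite dvdn_addl // (negbTE ndvd_sr).
- move: ND; rewrite -HF HF' dvdn_addr ?dvdn_mulr // dvdn_addr //.
  by rewrite (negbTE ndvd).
- have := dvdn_mulr D (dvdnn s); rewrite -HF HF' dvdn_addr ?dvdn_mulr //.
  by rewrite dvdn_addl // (negbTE ndvd_sr).
- by have -> : D = D' by apply/eqP; rewrite -(eqn_pmul2l s_gt0) -HF HF'.
Qed.

Definition transfer {L : nat} (x : bool * 'I_L.+1 -> nat) : bool * 'I_L.+1 -> nat :=
  shift (shift_data r s (colour x true) (colour x false)) x.

(** The class totals of the image reveal the recipe, and a known recipe can be undone. *)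
Lemma transfer_inj (L : nat) (x y : bool * 'I_L.+1 -> nat) : transfer x =1 transfer y -> x =1 y.
Proof.
move=> Hxy.
have Hcol b : colour (transfer x) b = colour (transfer y) b by apply: eq_bigr => j _.
move: Hxy (Hcol true) (Hcol false); rewrite /transfer.
case Ex: (shift_data _ _ (colour x _) _) => [[sw c] e].
case Ey: (shift_data _ _ (colour y _) _) => [[sw' c'] e'].
rewrite !colour_shift => Hxy Ht Hf.
have Eqp : (sw, c, e) = (sw', c', e').
  apply: (shift_data_inj _ _ _ _ _ _ _ _ _ _ Ex Ey).
    by case: (sw) (sw') Ht => -[].
  by case: (sw) (sw') Hf => -[].
by apply: (@shift_inj _ (sw, c, e)); rewrite {2}Eqp.
Qed.

Lemma sum_transfer (L : nat) (x : bool * 'I_L.+1 -> nat) :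
  \sum_i transfer x i * part 1 (r + s - 1) (r + s) i =
  \sum_i x i * part r s (r + s) i.
Proof.
rewrite !sum_part /transfer level_shift; congr addn.
case E: (shift_data _ _ _ _) => [[sw c] e]; rewrite !colour_shift.
have [D [F [ED EF]]] := shift_dataP _ _ _ _ _ E.
move=> CF.
have -> : r + s - 1 = r.-1 + s by lia.
have r_gt0 : 0 < r by lia.
rewrite {E} -(prednK r_gt0) in CF *; move: r.-1 CF => r' CF.
by case: CF ED EF => [[-> _ -> HF]|[-> _ -> HF _]|[-> _ -> HF _]] /= -> EF; nia.
Qed.

Lemma card_part_leq (L n : nat) :
  #|[set x : {ffun bool * 'I_L.+1 -> 'I_n.+1} |
     \sum_i x i * part r s (r + s) i == n]| <=
  #|[set x : {ffun bool * 'I_L.+1 -> 'I_n.+1} |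
     \sum_i x i * part 1 (r + s - 1) (r + s) i == n]|.
Proof.
apply: (@leq_card_weighted _ _ _ _ transfer).
- by case=> b j; rewrite /part /=; case: b; lia.
- exact: sum_transfer.
- exact: transfer_inj.
Qed.

End Transfer.

(** * The two directions of the equivalence *)

Lemma qexp_diff_ge0 (L m r : nat) (f g : nat -> int) (n : nat) :
  (0 < L)%N -> (1 < r)%N -> (r < m - r)%N -> ~~ (r %| (m - r))%N ->
  is_qexp_inv (qpoch 1 m L * qpoch (m - 1) m L)%R f ->
  is_qexp_inv (qpoch r m L * qpoch (m - r) m L)%R g ->
  (0 <= f n - g n)%R.
Proof.
case: L => // L _ r_gt1 lt_r ndvd Hf Hg.
rewrite (qexp_inv_part_count _ _ _ _ _ n _ _ Hf) //; last lia.
rewrite (qexp_inv_part_count _ _ _ _ _ n _ _ Hg); try lia.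
rewrite subr_ge0 ler_nat.
have := card_part_leq r (m - r) r_gt1 lt_r ndvd L n.
by have -> : r + (m - r) = m by lia.
Qed.

Lemma qexp_diff_lt0 (L m r : nat) (f g : nat -> int) :
  (0 < L)%N -> (1 < r)%N -> (r < m - 1)%N -> (r %| (m - r))%N ->
  is_qexp_inv (qpoch 1 m L * qpoch (m - 1) m L)%R f ->
  is_qexp_inv (qpoch r m L * qpoch (m - r) m L)%R g ->
  (f (m - r)%N - g (m - r)%N < 0)%R.
Proof.
case: L => // L _ r_gt1 lt_r dvdr Hf Hg.
rewrite (qexp_inv_part_count _ _ _ _ _ _ _ _ Hf) //; last lia.
rewrite (qexp_inv_part_count _ _ _ _ _ _ _ _ Hg); try lia.
rewrite subr_lt0 ltr_nat; set n := m - r.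
apply: (@leq_ltn_trans 1).
  apply/card_le1_eqP => x y; rewrite !inE => xP yP.
  have key (z : {ffun bool * 'I_L.+1 -> 'I_n.+1}) :
    \sum_i z i * part 1 (m - 1) m i == n ->
    forall i, z i = (if i == (true, ord0) then n else 0) :> nat.
    move=> /eqP zP.
    (* Every part other than [1] is at least [m - 1], which exceeds [n = m - r] because [1 < r]. *)
    have z0 i : i != (true, ord0) -> z i = 0 :> nat.
      move=> ni; apply/eqP; rewrite -leqn0 leqNgt; apply/negP => zi.
      have : z i * part 1 (m - 1) m i <= n by rewrite -[leqRHS]zP (bigD1 i) //= leq_addr.
      have : m - 1 <= part 1 (m - 1) m i.
        case: i ni {zi} => -[] j; rewrite /part /=; last lia.
        by rewrite xpair_eqE -val_eqE -lt0n /=; nia.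
      by move=> /(leq_mul zi) lo /(leq_trans lo); rewrite /n; lia.
    move=> i; case: eqP => [->|/eqP/z0 //].
    move: zP; rewrite (bigD1 (true, ord0)) //= big1 => [|j /z0 -> //].
    by rewrite /part /= muln0 muln1 addn0.
  by apply/ffunP => i; apply/val_inj; rewrite /= !key.
(* The two partitions of [n] will be [n %/ r] copies of [r] and a single [n]. *)
pose u k b : {ffun bool * 'I_L.+1 -> 'I_n.+1} :=
  [ffun i => if i == (b, ord0) then inord k else ord0].
have uP (k : nat) (b : bool) : k <= n -> k * (if b then r else n) = n ->
  u k b \in [set x : {ffun bool * 'I_L.+1 -> 'I_n.+1} |
     \sum_i x i * part r n m i == n].
  move=> le_kn Ek; rewrite inE (bigD1 (b, ord0)) //= big1 => [|i /negbTE ni].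
    by rewrite ffunE eqxx inordK // /part /= muln0 !addn0 Ek.
  by rewrite ffunE ni.
apply/card_gt1P; exists (u (n %/ r) true), (u 1 false); split.
- by apply: uP; rewrite ?leq_div // divnK.
- by apply: uP; rewrite ?mul1n // /n; lia.
apply/eqP => /ffunP/(_ (false, ord0)); rewrite !ffunE eqxx /=.
by move/(congr1 val); rewrite /= inordK // /n; lia.
Qed.

Theorem theorem4 (L m r : nat) (f g : nat -> int) :
  (0 < L)%N -> (1 < r)%N -> (r < m - 1)%N ->
  is_qexp_inv (qpoch 1 m L * qpoch (m - 1) m L) f ->
  is_qexp_inv (qpoch r m L * qpoch (m - r) m L) g ->
  ((forall n : nat, (0 <= f n - g n)%R) <->
   (~~ (r %| (m - r))%N /\ ~~ ((m - r) %| r)%N)).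
Proof.
move=> L_gt0 r_gt1 lt_r Hf Hg.
(* Exchanging [r] and [m - r] only swaps the factors of the second product, so each lemma also
   serves the mirrored case. *)
have rK : m - (m - r) = r by lia.
have Hg' : is_qexp_inv (qpoch (m - r) m L * qpoch (m - (m - r)) m L)%R g.
  by rewrite rK mulrC.
split=> [ge0|[ndvd ndvd'] n].
  split; apply/negP => dvd.
    have := qexp_diff_lt0 _ _ _ _ _ L_gt0 r_gt1 lt_r dvd Hf Hg.
    by rewrite ltNge ge0.
  have := qexp_diff_lt0 _ _ (m - r) _ _ L_gt0 _ _ _ Hf Hg'.
  by rewrite rK ltNge ge0 => H; suff: false by []; apply: H => //; lia.
case: (ltngtP r (m - r)) => [lt|gt|eq].
- exact: qexp_diff_ge0 Hf Hg.
- by apply: (qexp_diff_ge0 _ _ (m - r)) Hf Hg' => //; rewrite ?rK //; lia.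
- by rewrite -eq dvdnn in ndvd.
Qed.
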